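(* Let $X$, $Y$ be separable Banach spaces, $G \subset X$ an open set and $f: G \to Y$ a Lipschitz mapping. Then the set $A$ of all points $x \in G$ at which $f$ is Gâteaux differentiable, is Fréchet differentiable along a closed subspace of finite codimension (which may depend on $x$) but is not Fréchet differentiable, is $\sigma$-porous.
   Context: All Banach spaces are real and nontrivial ($\neq\{0\}$), with norm denoted $|\cdot|$. A subspace of a Banach space means a closed linear subspace $\neq\{0\}$. $B(x,r)$ is the open ball. For a closed subspace $V$ of $X$, $f$ is Fréchet differentiable at $x\in G$ along $V$ if the mapping $g(v):=f(x+v)$, $v\in V\cap(G-x)$, is Fréchet differentiable at $0\in V$. A set $A\subset X$ is porous at $x\in X$ if there exists $c>0$ such that for each $\delta>0$ there exists $t\in B(x,\delta)\setminus\{x\}$ with $B(t,c|t-x|)\cap A=\emptyset$. $A$ is porous if it is porous at each of its points, and $\sigma$-porous if it is a countable union of porous sets. *)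

(* Defs.v *)
From HB Require Import structures.
From mathcomp Require Import all_boot all_order all_algebra.
From mathcomp Require Import all_classical all_reals all_analysis.

Set Implicit Arguments.
Unset Strict Implicit.
Unset Printing Implicit Defensive.

Import Order.TTheory GRing.Theory Num.Theory.
Import numFieldNormedType.Exports.

Local Open Scope classical_set_scope.
Local Open Scope ring_scope.

Definition separable (T : topologicalType) : Prop :=
  exists2 D : set T, countable D & dense D.

Section ClosedSubspaces.
Context (R : realType) (X : normedModType R).

(* Nontriviality is part of the notion: {0} is not counted as a subspace. *)
Record closedSubspace := ClosedSubspace {
  subspace_set : set X;
  subspace_submod : submod_closed (mem subspace_set);
  subspace_closed : closed subspace_set;
  subspace_neq0 : exists2 v, subspace_set v & v != 0
}.

Definition subspace_pred (V : closedSubspace) : {pred X} :=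
  mem (subspace_set V).

Fact subspace_pred_submod V : submod_closed (subspace_pred V).
Proof. exact: (subspace_submod V). Qed.

HB.instance Definition _ (V : closedSubspace) :=
  GRing.isSubmodClosed.Build R X (subspace_pred V) (subspace_pred_submod V).

(* A closed subspace as a normed space in its own right. *)
Definition subspace_type (V : closedSubspace) : Type :=
  {x : X | x \in subspace_pred V}.

HB.instance Definition _ V := SubType.on (subspace_type V).
HB.instance Definition _ V := [Choice of subspace_type V by <:].
HB.instance Definition _ V :=
  [SubChoice_isSubLmodule of subspace_type V by <:].

Definition subspace_norm V (v : subspace_type V) : R := `|val v|.

Fact subspace_normD V (v w : subspace_type V) :
  subspace_norm (v + w) <= subspace_norm v + subspace_norm w.
Proof. by rewrite /subspace_norm raddfD; exact: ler_normD. Qed.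

Fact subspace_normZ V (a : R) (v : subspace_type V) :
  subspace_norm (a *: v) = `|a| * subspace_norm v.
Proof. by rewrite /subspace_norm linearZ; exact: normrZ. Qed.

Fact subspace_norm_eq0 V (v : subspace_type V) : subspace_norm v = 0 -> v = 0.
Proof.
move=> v0; apply/val_inj; rewrite raddf0.
by apply/eqP; rewrite -normr_eq0 -/(subspace_norm v) v0.
Qed.

HB.instance Definition _ V := Lmodule_isNormed.Build R (subspace_type V)
  (@subspace_normD V) (@subspace_normZ V) (@subspace_norm_eq0 V).

(* The quotient X / V is spanned by the classes of finitely many vectors. *)
Definition finite_codim (V : closedSubspace) : Prop :=
  exists (n : nat) (e : 'I_n -> X), forall x : X,
    exists c : 'I_n -> R, subspace_set V (x - \sum_(i < n) c i *: e i).

End ClosedSubspaces.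

Section Differentiability.
Context (R : realType) (X Y : normedModType R).

(* f is a total function; when it stands for a mapping defined on an open set
   G containing x, the two notions below depend only on f restricted to G. *)

Definition gateaux_differentiable (f : X -> Y) (x : X) : Prop :=
  exists L : {linear X -> Y}, continuous L /\ forall v, is_derive x v f (L v).

Definition frechet_differentiable_along (V : closedSubspace X) (f : X -> Y)
    (x : X) : Prop :=
  differentiable (fun v : subspace_type V => f (x + val v))
    (0 : subspace_type V).

End Differentiability.

Section Porosity.
Context (R : realType) (X : normedModType R).

Definition porous_at (A : set X) (x : X) : Prop :=
  exists2 c : R, 0 < c & forall delta : R, 0 < delta ->
    exists t : X, [/\ ball x delta t, t != x &
      ball t (c * `|t - x|) `&` A = set0].

Definition porous (A : set X) : Prop := forall x, A x -> porous_at A x.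

Definition sigma_porous (A : set X) : Prop :=
  exists2 F : nat -> set X, (forall n, porous (F n)) & A = \bigcup_n F n.

End Porosity.

(* Main.v *)
(* Fix e > 0 and finitely many directions d_i of a dense sequence.  Sort the
   points x by e, the d_i, approximate values y_i of f'(x) d_i, and the uniform
   scale at which f(x + t d_i) - f(x) is close to t y_i.  A point x of one piece
   has increments that are bad for Frechet differentiability (with constant e),
   while every small h splits as w + sum_i a_i d_i with a_i = O(|h|) and f well
   approximated by f'(x) along w: d_i spans, up to a small error, a complement
   of the subspace of Frechet differentiability at x.  If the piece were not
   porous at x, one could walk from x + w to x + h adding the a_i d_i one at a
   time, replacing each starting point by a nearby point of the same piece,
   where the increment along d_i is known; so h would not be bad.  Only the
   directional behaviour along d_i is used at the auxiliary points, so it is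
   harmless that the subspace depends on the point. *)
Require Import Defs.
From HB Require Import structures.
From mathcomp Require Import all_boot all_order all_algebra.
From mathcomp Require Import all_classical all_reals all_analysis.
From mathcomp Require Import lra ring.

Set Implicit Arguments.
Unset Strict Implicit.
Unset Printing Implicit Defensive.

Import Order.TTheory GRing.Theory Num.Theory.
Import numFieldNormedType.Exports.
Local Open Scope classical_set_scope.
Local Open Scope ring_scope.

(** * Coordinates modulo a closed subspace of finite codimension *)

Section FiniteCodimension.
Context (R : realType) (X : normedModType R).

(** A ball of radius [r] around [e] misses [V]; scaling by [a] gives the bound. *)
Lemma line_coef_bound (V : {pred X}) (e : X) :
  submod_closed V -> closed [set` V] -> e \notin V ->
  exists2 r : R, 0 < r & forall v a, v \in V -> r * `|a| <= `|v + a *: e|.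
Proof.
move=> [V0 VD] Vcl eV.
have /nbhs_ballP[r /= r0 rV] : nbhs e (~` [set` V]).
  by apply: open_nbhs_nbhs; split; [exact: closed_openC|exact/negP].
exists r => // v a vV.
have [->|a0] := eqVneq a 0; first by rewrite normr0 mulr0.
have -> : v + a *: e = a *: (e - (- a^-1 *: v)).
  by rewrite scalerBr scaleNr scalerN opprK scalerA divff// scale1r addrC.
rewrite normrZ mulrC ler_wpM2l// leNgt; apply/negP => er.
have := rV (- a^-1 *: v); rewrite -ball_normE => /(_ er); apply => /=.
by rewrite -[X in X \in V]addr0; exact: VD.
Qed.

Lemma submod_closed_add_line (V : {pred X}) (e : X) :
  submod_closed V -> submod_closed [pred x | `[< exists a, x - a *: e \in V >]].
Proof.
move=> [V0 VD]; split; first by apply/asboolP; exists 0; rewrite scale0r subr0.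
move=> c u v /asboolP[a uV] /asboolP[b vV]; apply/asboolP; exists (c * a + b).
suff -> : c *: u + v - (c * a + b) *: e = c *: (u - a *: e) + (v - b *: e).
  exact: VD.
by rewrite scalerBr scalerDl scalerA opprD addrACA.
Qed.

(** By [line_coef_bound], good approximations of [x] have nearly equal coefficients along [e], so a
    limit coefficient exists by completeness of [R]. *)
Lemma closed_add_line (V : {pred X}) (e : X) :
  submod_closed V -> closed [set` V] ->
  closed [set` [pred x | `[< exists a, x - a *: e \in V >]]].
Proof.
move=> Vm Vcl; have [V0 VD] := Vm.
have VB u v : u \in V -> v \in V -> u - v \in V.
  by move=> uV vV; rewrite addrC -scaleN1r; exact: VD.
have [eV|eV] := boolP (e \in V).
  rewrite (_ : [set` _] = [set` V])//; apply/seteqP; split => x /=.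
    move=> /asboolP[a xV]; rewrite -(subrK (a *: e) x) addrC.
    exact: VD.
  by move=> xV; apply/asboolP; exists 0; rewrite scale0r subr0.
have [r r0 rV] := line_coef_bound Vm Vcl eV.
move=> x clx; apply/asboolP.
have near_x (eps : R) : 0 < eps ->
    exists a, exists2 v, v \in V & `|x - v - a *: e| < eps.
  move=> eps0; have [z [/asboolP[a zV]]] := clx _ (nbhsx_ballx x eps eps0).
  rewrite -ball_normE /= => xz; exists a, (z - a *: e) => //.
  by rewrite opprB addrA addrAC addrK.
(* Coefficients admissible at precisions eps and eps' differ by at most
   (eps + eps') / r, so the sup of the a - eps / r is within eps / r of every a
   admissible at precision eps: no convergent sequence is needed. *)
pose S := [set b | exists eps a, [/\ 0 < eps,
  exists2 v, v \in V & `|x - v - a *: e| < eps & b = a - eps / r]].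
have S_ub eps a : 0 < eps -> (exists2 v, v \in V & `|x - v - a *: e| < eps) ->
    ubound S (a + eps / r).
  move=> eps0 [v vV xv] _ [eps' [b [eps'0 [w wV xw] ->]]].
  rewrite lerBlDr -addrA -mulrDl -lerBlDl ler_pdivlMr// mulrC.
  have rba := rV (w - v) (b - a) (VB _ _ wV vV).
  apply: (@le_trans _ _ (r * `|b - a|)).
    by rewrite ler_wpM2l ?ler_norm// ltW.
  apply: le_trans rba _.
  have -> : w - v + (b - a) *: e = (x - v - a *: e) - (x - w - b *: e).
    rewrite -!(addrA x) -(opprD v) -(opprD w) opprB [RHS]addrC.
    by rewrite addrA subrK addrC scalerBl opprD addrACA.
  apply: le_trans (ler_normB _ _) _.
  by rewrite lerD// ltW.
have [a0 [v0 v0V xv0]] := near_x 1 ltr01.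
have S_sup : has_sup S.
  split; last by exists (a0 + 1 / r); apply: S_ub => //; exists v0.
  by exists (a0 - 1 / r), 1, a0; split => //; exists v0.
have e1 : 0 < 1 + `|e| / r by rewrite ltr_pwDl// divr_ge0// ltW.
exists (sup S); apply: Vcl => B /nbhs_ballP[d /= d0 dB].
(* The precision [eps] solves [eps + (eps / r) * |e| = d]; the second term pays for replacing [a] by
   [sup S]. *)
have [|a [v vV xv]] := near_x (d / (1 + `|e| / r)); first by rewrite divr_gt0.
set eps := d / _ in xv; have eps0 : 0 < eps by rewrite divr_gt0.
exists v; split => //; apply: dB; rewrite -ball_normE /=.
have le_a : `|a - sup S| <= eps / r.
  rewrite ler_distlC; apply/andP; split.
    by apply: sup_ubound S_sup.2 _ _; exists eps, a; split => //; exists v.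
  by apply: ge_sup S_sup.1 _; apply: S_ub => //; exists v.
have -> : x - sup S *: e - v = (x - v - a *: e) + (a - sup S) *: e.
  by rewrite scalerBl subrKA addrAC.
apply: le_lt_trans (ler_normD _ _) _.
have -> : d = eps + (eps / r) * `|e|
  by rewrite -[X in X + _]mulr1 -mulrA -mulrDr (mulrC r^-1) divfK// gt_eqF.
by rewrite ltr_leD// normrZ ler_wpM2r.
Qed.

(** Induction on [n], absorbing the last vector into [V]. The [e i] may be dependent modulo [V]: if
    [e n] lies in [V], its coefficient is taken to be 0. *)
Lemma bounded_coordinates n (V : {pred X}) (e : nat -> X) :
  submod_closed V -> closed [set` V] ->
  (forall x : X, exists c : nat -> R, x - \sum_(0 <= i < n) c i *: e i \in V) ->
  exists2 M : R, 0 < M & forall x : X, exists c : nat -> R,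
    (forall i, (i < n)%N -> `|c i| <= M * `|x|) /\
    x - \sum_(0 <= i < n) c i *: e i \in V.
Proof.
elim: n V => [|n IHn] V Vm Vcl eV.
  exists 1 => // x; have [c xV] := eV x; exists c; split => //.
have [||M M0 MV] := IHn _ (submod_closed_add_line (e n) Vm).
- exact: closed_add_line.
- move=> x; have [c] := eV x; rewrite big_nat_recr//= opprD addrA => xV.
  by exists c; apply/asboolP; exists (c n).
pose B := 1 + \sum_(0 <= i < n) M * `|e i|.
have B1 : 1 <= B by rewrite lerDl sumr_ge0// => i _; rewrite mulr_ge0// ltW.
have B0 := lt_le_trans ltr01 B1.
have rem_le x (c : nat -> R) : (forall i, (i < n)%N -> `|c i| <= M * `|x|) ->
    `|x - \sum_(0 <= i < n) c i *: e i| <= B * `|x|.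
  move=> cM; rewrite mulrDl mul1r (le_trans (ler_normB _ _))// lerD2l.
  rewrite mulr_suml (le_trans (ler_norm_sum _ _ _))// big_nat [leRHS]big_nat.
  by apply: ler_sum => i /cM ci; rewrite normrZ mulrAC ler_wpM2r.
have [r r0 rV] : exists2 r, 0 < r & forall v,
    [pred x | `[< exists a, x - a *: e n \in V >]] v ->
    exists a, r * `|a| <= `|v| /\ v - a *: e n \in V.
  have [enV|enV] := boolP (e n \in V).
    exists 1 => // v /asboolP[a vV]; exists 0.
    rewrite normr0 mulr0; split => //; rewrite scale0r subr0.
    by rewrite -(subrK (a *: e n) v) addrC; apply: Vm.2.
  have [r r0 rV] := line_coef_bound Vm Vcl enV.
  exists r => // v /asboolP[a vV]; exists a; split => //.
  by have := rV _ a vV; rewrite subrK.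
exists (Num.max M (B / r)) => [|x]; first by rewrite lt_max M0.
have [c [cM /rV[a [ra aV]]]] := MV x.
exists (fun i => if (i < n)%N then c i else a); split.
  move=> i; rewrite ltnS; case: ltnP => [/cM ci _|_ _].
    by rewrite (le_trans ci)// ler_wpM2r// le_max lexx.
  apply: (@le_trans _ _ (B / r * `|x|)); last first.
    by rewrite ler_wpM2r// le_max lexx orbT.
  rewrite mulrAC ler_pdivlMr// mulrC (le_trans ra)//.
  exact: rem_le.
rewrite big_nat_recr//= ltnn opprD addrA.
by rewrite (eq_big_nat _ _ (F2 := fun i => c i *: e i))// => i /andP[_ ->].
Qed.

End FiniteCodimension.

(** * Differentiability in epsilon-delta form *)

Section DifferentiabilityEstimates.
Context (R : realType) (X Y : normedModType R).
Implicit Types (f : X -> Y) (x v : X).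

Lemma is_derive_estimate f x v (l : Y) : is_derive x v f l ->
  forall eps : R, 0 < eps -> exists2 delta : R, 0 < delta &
    forall t : R, `|t| < delta ->
      `|f (x + t *: v) - f x - t *: l| <= eps * `|t|.
Proof.
move=> [dfx <-] eps eps0; have /eqaddoP/(_ eps eps0) := derivable_nbhs dfx.
move=> /nbhs_norm0P[delta /= delta0 fdelta]; exists delta => // t /fdelta /=.
by rewrite !fctE /= opprD addrA (addrC x).
Qed.

(** Otherwise [L] would satisfy the definition of the Fréchet derivative at [x]. *)
Lemma not_differentiable_estimate f x (L : {linear X -> Y}) : continuous L ->
  ~ differentiable f x -> exists2 eps : R, 0 < eps &
    forall delta : R, 0 < delta -> exists2 h, `|h| < delta &
      eps * `|h| < `|f (x + h) - f x - L h|.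
Proof.
move=> Lc; apply: contra_notP => /forall2NP nd.
have fL : f \o shift x = cst (f x) + L +o_ 0 id.
  apply/eqaddoP => eps eps0; have [//|/existsNP[delta]] := nd eps.
  move=> /not_implyP[delta0 /forall2NP hd]; apply/nbhs_norm0P.
  exists delta => //= h /= hdelta; have [//|/negP] := hd h.
  by rewrite -leNgt !fctE /= opprD addrA (addrC h).
by apply/diff_locallyP; rewrite (diff_unique Lc fL).
Qed.

(** The derivative along [V] is the restriction of [L]: both are limits of the same difference
    quotients. *)
Lemma frechet_along_estimate f x (V : closedSubspace X) (L : {linear X -> Y}) :
  (forall v, is_derive x v f (L v)) -> frechet_differentiable_along V f x ->
  forall eps : R, 0 < eps -> exists2 delta : R, 0 < delta &
    forall v, subspace_set V v -> `|v| < delta ->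
      `|f (x + v) - f x - L v| <= eps * `|v|.
Proof.
move=> dL df eps eps0; have /eqaddoP/(_ eps eps0) := diff_locally df.
move=> /nbhs_norm0P[delta /= delta0 fdelta]; exists delta => // v vV vdelta.
pose w : subspace_type V := exist _ v (mem_set vV).
have fw := fdelta w vdelta; move: fw.
rewrite !fctE /= !addr0 opprD addrA.
suff -> : 'd (fun v : subspace_type V => f (x + val v)) 0 w = L v by [].
rewrite -deriveE// -(@derive_val _ _ _ _ _ _ _ (dL v)) /derive.
apply: (congr1 (fun g : R -> Y => lim (g @ 0^'))); apply/funext => h /=.
by rewrite !addr0 (addrC x).
Qed.

End DifferentiabilityEstimates.

(** * Countable covers, dense sequences and the Lipschitz constant *)

(** Subsets of porous sets are porous, so each [F i] can be cut down to [A]; numbers that code no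
    index give the empty set. *)
Lemma countable_union_sigma_porous (R : realType) (X : normedModType R)
  (I : countType) (F : I -> set X) (A : set X) :
  (forall i, porous (F i)) -> A `<=` \bigcup_i F i -> sigma_porous A.
Proof.
move=> Fp AF.
exists (fun n => if unpickle n is Some i then A `&` F i else set0).
  move=> n x; case: unpickle => // i [_] /(Fp i x)[c c0 Fc]; exists c => //.
  move=> delta /Fc[t [xt tx tF]]; exists t; split => //.
  by rewrite setIC -setIA (setIC (F i)) tF setI0.
apply/seteqP; split => [x Ax|x [n _]]; last by case: unpickle => // i [].
by have [i _ Fix] := AF x Ax; exists (pickle i) => //; rewrite pickleK.
Qed.

Lemma separable_dense_seq (R : realType) (X : normedModType R) : separable X ->
  exists u : nat -> X, forall x (e : R), 0 < e -> exists k, `|x - u k| < e.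
Proof.
move=> [D Dc Dd].
have near_D x (e : R) : 0 < e -> exists2 y, D y & `|x - y| < e.
  move=> e0; have [||y [xy Dy]] := Dd (ball x e).
  - by exists x; exact: ballxx.
  - exact: ball_open.
  by exists y => //; move: xy; rewrite -ball_normE.
have [y0 Dy0 _] := near_D 0 1 ltr01.
have /pfcard_geP[D0|[u]] := Dc; first by move: Dy0; rewrite D0.
exists u => x e /(near_D x)[y Dy xy].
by have [k _ uk] := @surj _ _ _ _ u y Dy; exists k; rewrite uk.
Qed.

Lemma lipschitz_bound (R : realType) (X Y : normedModType R) (G : set X)
  (f : X -> Y) : [lipschitz f x | x in G] ->
  exists2 K : R, 0 < K & {in G &, forall x y, `|f x - f y| <= K * `|x - y|}.
Proof.
move=> /pinfty_ex_gt0[K K0 fK]; exists K => // x y /set_mem Gx /set_mem Gy.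
exact: (fK (x, y)).
Qed.

Lemma natr_divS_le1 (R : numFieldType) k : k%:R / k.+1%:R <= 1 :> R.
Proof. by rewrite ler_pdivrMr// mul1r ler_nat. Qed.

(** * Porosity of the pieces, and their covering property *)

Section Pieces.
Context (R : realType) (X Y : normedModType R) (G : set X) (f : X -> Y).

(* The constant 16 * (M.+1 * n.+1) makes the errors in the last two clauses add
   up to at most e / 8 * |h| over n steps a_i *: d_i with |a_i| <= M * |h|. *)
Definition piece (e : R) (M m n : nat) (d : nat -> X) (y : nat -> Y) : set X :=
  [set x | G x /\ exists L : {linear X -> Y}, [/\
    forall delta : R, 0 < delta -> exists2 h, `|h| < delta &
      e * `|h| < `|f (x + h) - f x - L h|,
    exists2 delta : R, 0 < delta & forall h, `|h| < delta ->
      exists a : nat -> R,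
      (forall i, (i < n)%N -> `|a i| <= M%:R * `|h|) /\
      let w := h - \sum_(0 <= i < n) a i *: d i in
      `|f (x + w) - f x - L w| <= e / 4 * `|h|,
    forall i, (i < n)%N -> `|L (d i) - y i| <= e / (16 * (M.+1 * n.+1)%:R) &
    forall i (t : R), (i < n)%N -> `|t| < m.+1%:R^-1 ->
      `|f (x + t *: d i) - f x - t *: y i|
        <= e / (16 * (M.+1 * n.+1)%:R) * `|t| ]].

Lemma piece_porous (K e : R) (M m n : nat) (d : nat -> X) (y : nat -> Y) :
  open G -> 0 < K -> {in G &, forall x z, `|f x - f z| <= K * `|x - z|} ->
  0 < e -> porous (piece e M m n d y).
Proof.
move=> Gop K0 fK e0 x Px; have [Gx [L [Lbad Lgood Ly _]]] := Px.
set e1 := e / (16 * (M.+1 * n.+1)%:R) in Ly *.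
have e10 : 0 < e1 by rewrite divr_gt0// mulr_gt0// ltr0n.
pose C : R := 1 + M%:R * \sum_(0 <= i < n) `|d i|.
have C0 : 0 < C by rewrite ltr_pwDl// mulr_ge0// sumr_ge0.
(* Each step of the walk costs two Lipschitz errors of size [K * c * C * |h|]; with this [c] the [n]
   steps together cost at most [e / 4 * |h|]. *)
pose c : R := e / (8 * K * C * n.+1%:R).
have c0 : 0 < c by rewrite divr_gt0// !mulr_gt0.
exists c => //; apply: contrapT.
move=> /existsNP[delta /not_implyP[delta0 /forallNP hole]].
(* For u = x the hole condition is void, but x itself is the nearby point. *)
have near_piece u : `|u - x| < delta ->
    exists2 z, piece e M m n d y z & `|u - z| <= c * `|u - x|.
  move=> ux; have [->|u_neq_x] := eqVneq u x.
    by exists x => //; rewrite !subrr normr0 mulr0.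
  have /not_and3P[] := hole u.
  - by rewrite -ball_normE /= distrC.
  - by rewrite u_neq_x.
  - move=> /eqP/set0P[z [uz Pz]]; exists z => //.
    by apply: ltW; move: uz; rewrite -ball_normE.
have /nbhs_ballP[rho /= rho0 rhoG] : nbhs x G by exact: open_nbhs_nbhs.
have [delta1 delta10 good] := Lgood.
(* In order: [h] splits; every [p k] is within [delta] of [x]; all points used stay in [G]; every
   [a k] is below the scale of the piece. *)
pose r := Num.min (Num.min delta1 (delta / C))
  (Num.min (rho / (C + c * C)) (m.+1%:R^-1 / M.+1%:R)).
have D0 : 0 < C + c * C by rewrite addr_gt0// mulr_gt0.
have r0 : 0 < r by rewrite !lt_min delta10 !divr_gt0// invr_gt0.
have [h] := Lbad r r0; rewrite !lt_min => /andP[/andP[h1 h2] /andP[h3 h4]].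
move: h2 h3 h4; rewrite !ltr_pdivlMr// => h2 h3 h4.
apply/negP; rewrite -leNgt; have [a [aM aw]] := good h h1.
(* The walk runs from [p 0 = x + w] to [p n = x + h], adding [a k *: d k] at step [k]. *)
pose p k := x + (h - \sum_(k <= i < n) a i *: d i).
have p_near k : `|p k - x| <= C * `|h|.
  rewrite /p addrC addKr (le_trans (ler_normB _ _))// mulrDl mul1r lerD2l.
  rewrite (le_trans (ler_norm_sum _ _ _))//.
  have [kn|kn] := leqP k n; last first.
    by rewrite big_geq 1?ltnW// !mulr_ge0// sumr_ge0.
  rewrite mulrAC mulr_sumr [leRHS](big_cat_nat _ kn)//=.
  apply: ler_wpDl; first by apply: sumr_ge0 => i _; rewrite !mulr_ge0.
  rewrite big_nat [leRHS]big_nat; apply: ler_sum => i /andP[_ /aM ai].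
  by rewrite normrZ ler_wpM2r.
have inG u : `|u - x| < rho -> G u.
  by move=> ux; apply: rhoG; rewrite -ball_normE /= distrC.
have h_le s : s * `|h| < rho -> forall u, `|u - x| <= s * `|h| -> u \in G.
  by move=> sh u us; apply/mem_set/inG/(le_lt_trans us).
have pG k : p k \in G.
  apply: (h_le C _ _ (p_near k)); apply: le_lt_trans h3.
  by rewrite mulrC ler_wpM2l// lerDl mulr_ge0// ltW.
pose b := (2 * (K * c * C) + 2 * e1 * M%:R) * `|h|.
have step k : (k < n)%N -> `|f (p k.+1) - f (p k) - L (p k.+1 - p k)| <= b.
  move=> kn; have pS : p k.+1 = p k + a k *: d k.
    by rewrite /p [in RHS]big_ltn// opprD [- (a k *: _) - _]addrC !addrA subrK.
  have [|z [Gz [Lz [_ _ _ zder]]] pz] := near_piece (p k).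
    by apply: le_lt_trans (p_near k) _; rewrite mulrC.
  have pz_le : `|p k - z| <= c * C * `|h|.
    by rewrite (le_trans pz)// -mulrA ler_wpM2l// ltW.
  have ak := aM k kn.
  have akm : `|a k| < m.+1%:R^-1.
    apply: le_lt_trans h4; rewrite mulrC (le_trans ak)// ler_wpM2r//.
    by rewrite ler_nat.
  have pz' : p k.+1 - (z + a k *: d k) = p k - z.
    by rewrite pS opprD addrACA subrr addr0.
  have zG : z + a k *: d k \in G.
    apply: (h_le (C + c * C)); first by rewrite mulrC.
    have -> : z + a k *: d k - x = (p k.+1 - x) - (p k - z).
      by rewrite -pz' opprB [RHS]addrC subrKA.
    by rewrite mulrDl (le_trans (ler_normB _ _))// lerD// p_near.
  (* The value [y k], shared by [x] and [z], links the increment at [z] to [L (d k)]; the outer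
     differences of [f] are Lipschitz errors. *)
  have -> : f (p k.+1) - f (p k) - L (p k.+1 - p k) =
      (f (p k.+1) - f (z + a k *: d k)) +
      (f (z + a k *: d k) - f z - a k *: y k) +
      (f z - f (p k)) - a k *: (L (d k) - y k).
    rewrite {2}pS [p k + _]addrC addrK linearZ/= scalerBr opprB.
    by rewrite (addrA (f (p k.+1) - _)) subrKA (addrAC _ _ (f z - _)) !subrKA.
  rewrite (le_trans (ler_normB _ _))//.
  have -> : b = K * (c * C * `|h|) + e1 * (M%:R * `|h|) + K * (c * C * `|h|)
      + M%:R * `|h| * e1 by rewrite /b; ring.
  have Kpz : K * `|p k - z| <= K * (c * C * `|h|) by rewrite ler_pM2l.
  rewrite lerD//; last by rewrite normrZ ler_pM// Ly.
  rewrite (le_trans (ler_normD _ _))// lerD//; last first.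
    by rewrite distrC (le_trans _ Kpz)// fK// inE.
  rewrite (le_trans (ler_normD _ _))// lerD//.
    by rewrite (le_trans _ Kpz)// -pz' fK.
  by rewrite (le_trans (zder _ _ kn akm))// ler_wpM2l// ltW.
have walk k : (k <= n)%N ->
    `|f (p k) - f (p 0%N) - L (p k - p 0%N)| <= b *+ k.
  elim: k => [_|k IHk kn]; first by rewrite !subrr linear0 subr0 normr0.
  have -> : f (p k.+1) - f (p 0%N) - L (p k.+1 - p 0%N) =
      (f (p k.+1) - f (p k) - L (p k.+1 - p k)) +
      (f (p k) - f (p 0%N) - L (p k - p 0%N)).
    by rewrite addrACA subrKA -opprD -linearD subrKA.
  by rewrite mulrS (le_trans (ler_normD _ _))// lerD ?step ?IHk// ltnW.
have -> : f (x + h) - f x - L h = (f (p n) - f (p 0%N) - L (p n - p 0%N)) +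
    (f (p 0%N) - f x - L (p 0%N - x)).
  rewrite addrACA subrKA -opprD -linearD subrKA /p big_geq// subr0.
  by rewrite [x + h - x]addrAC subrr add0r.
rewrite (le_trans (ler_normD _ _))//.
have -> : p 0%N - x = h - \sum_(0 <= i < n) a i *: d i.
  by rewrite /p addrAC subrr add0r.
apply: le_trans (lerD (walk n (leqnn n)) aw) _.
rewrite -mulr_natr /b.
have -> : (2 * (K * c * C) + 2 * e1 * M%:R) * `|h| * n%:R + e / 4 * `|h| =
  (e / 4 * (n%:R / n.+1%:R) + e / 8 * (M%:R / M.+1%:R) * (n%:R / n.+1%:R)
    + e / 4) * `|h|.
  rewrite /c /e1 natrM; field.
  by rewrite !gt_eqF.
rewrite ler_wpM2r// -(mulrA (e / 8)).
have nn1 := natr_divS_le1 R n.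
have mn1 : (M%:R / M.+1%:R) * (n%:R / n.+1%:R) <= 1 :> R.
  by rewrite mulr_ile1// natr_divS_le1.
(* Replacements, directional errors and the initial estimate at [x + w] add up to [5 * e / 8]. *)
apply: (@le_trans _ _ (e / 4 * 1 + e / 8 * 1 + e / 4)); last by lra.
by rewrite lerD2r lerD// ler_wpM2l// divr_ge0// ltW.
Qed.

(** The list [s] records which [u k] approximate the vectors spanning a complement of [V], and which
    [w k] approximate their images under [L]. *)
Lemma piece_cover (K : R) (u : nat -> X) (w : nat -> Y) :
  open G -> 0 < K -> {in G &, forall x z, `|f x - f z| <= K * `|x - z|} ->
  (forall x (e : R), 0 < e -> exists k, `|x - u k| < e) ->
  (forall y (e : R), 0 < e -> exists k, `|y - w k| < e) ->
  forall x, G x -> gateaux_differentiable f x ->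
  (exists V : closedSubspace X,
    finite_codim V /\ frechet_differentiable_along V f x) ->
  ~ differentiable f x ->
  exists q M m (s : seq (nat * nat)),
    piece q.+1%:R^-1 M m (size s) (fun i => u (nth (0, 0)%N s i).1)
      (fun i => w (nth (0, 0)%N s i).2) x.
Proof.
move=> Gop K0 fK u_dense w_dense x Gx [L [Lc dL]] [V [[n [e0 Ve0]] Vf]] nd.
have [eps eps0 Leps] := not_differentiable_estimate Lc nd.
have [q qeps] : exists q, q.+1%:R^-1 < eps.
  by exists (Num.truncn eps^-1); rewrite invf_plt ?posrE// truncnS_gt.
set e := q.+1%:R^-1 in qeps.
have e_gt0 : 0 < e by rewrite invr_gt0.
pose v i : X := if insub i is Some j then e0 j else 0.
have Vv z : exists c : nat -> R,
    z - \sum_(0 <= i < n) c i *: v i \in subspace_pred V.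
  have [c Vc] := Ve0 z; exists (fun i => if insub i is Some j then c j else 0).
  rewrite big_mkord; under eq_bigr do rewrite /v valK.
  exact/mem_set.
have Vcl : closed [set` subspace_pred V].
  rewrite (_ : [set` _] = subspace_set V); first exact: subspace_closed.
  by apply/seteqP; split => z; [move/set_mem|move/mem_set].
have [M0 M00 VM0] := bounded_coordinates (subspace_pred_submod V) Vcl Vv.
have [M M0M] : exists M, M0 <= M%:R.
  by exists (Num.truncn M0).+1; rewrite ltW// truncnS_gt.
have [KL KL0 LKL] : exists2 KL : R, 0 < KL & forall z, `|L z| <= KL * `|z|.
  have /linear_bounded_continuous/linear_boundedP := Lc.
  by move=> /pinfty_ex_gt0[KL KL0 LKL]; exists KL.
pose e1 := e / (16 * (M.+1 * n.+1)%:R).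
have e10 : 0 < e1 by rewrite divr_gt0.
(* Replacing [v i] by [u (ku i)] then moves the remainder by at most [D * |h|], where
   [(K + KL) * D = e / 8]. *)
pose eta := e / (8 * (K + KL) * (M.+1 * n.+1)%:R).
have eta0 : 0 < eta by rewrite divr_gt0// !mulr_gt0// addr_gt0.
have [ku kuP] := choice (fun i => u_dense (v i) eta eta0).
have e1h : 0 < e1 / 2 by rewrite divr_gt0.
(* Half of [e1] is for approximating [L (u (ku i))], half for the difference quotient in that
   direction. *)
have [kw kwP] := choice (fun i => w_dense (L (u (ku i))) (e1 / 2) e1h).
have ex_del i : exists del, 0 < del /\ forall t : R, `|t| < del ->
    `|f (x + t *: u (ku i)) - f x - t *: L (u (ku i))| <= e1 / 2 * `|t|.
  by have [di di0 diP] := is_derive_estimate (dL (u (ku i))) e1h; exists di.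
have [del delP] := choice ex_del.
(* One scale serves all directions since only [n] of them occur. *)
have [m mdel] : exists m, forall i, (i < n)%N -> m.+1%:R^-1 < del i.
  exists (\max_(i < n) Num.truncn (del i)^-1) => i iN.
  have [di0 _] := delP i.
  rewrite invf_plt ?posrE//; apply: lt_le_trans (truncnS_gt _) _.
  by rewrite ler_nat ltnS (leq_bigmax (Ordinal iN)).
exists q, M, m, (mkseq (fun i => (ku i, kw i)) n); rewrite size_mkseq.
split=> //; exists L; split.
- move=> d d0; have [h hd hL] := Leps d d0; exists h => //.
  by apply: le_lt_trans hL; rewrite ler_wpM2r// ltW.
- pose C : R := 1 + \sum_(0 <= i < n) M0 * `|v i|.
  have C0 : 0 < C.
    rewrite (lt_le_trans ltr01)// lerDl sumr_ge0// => i _.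
    by rewrite mulr_ge0// ltW.
  have C8 : 0 < e / (8 * C) by rewrite divr_gt0// mulr_gt0.
  have [delV delV0 VL] := frechet_along_estimate dL Vf C8.
  have /nbhs_ballP[rho /= rho0 rhoG] : nbhs x G by exact: open_nbhs_nbhs.
  pose D := e / (8 * (K + KL)).
  have D0 : 0 < D by rewrite divr_gt0// mulr_gt0// addr_gt0.
  have CD0 : 0 < C + D by rewrite addr_gt0.
  exists (Num.min (delV / C) (rho / (C + D))).
    by rewrite lt_min !divr_gt0.
  move=> h; rewrite lt_min !ltr_pdivlMr// => /andP[hV hrho].
  have [c [cM /set_mem Vc]] := VM0 h; exists c; split.
    by move=> i /cM ci; rewrite (le_trans ci)// ler_wpM2r.
  rewrite /= (eq_big_nat _ _ (F2 := fun i => c i *: u (ku i))); last first.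
    by move=> i /andP[_ iN]; rewrite nth_mkseq.
  (* The remainder [v0] lies in [V], where the Fréchet estimate holds; [w0] is the nearby remainder
     for the dense directions. *)
  set v0 := h - _ in Vc; set w0 := h - _.
  have v0_le : `|v0| <= C * `|h|.
    rewrite mulrDl mul1r (le_trans (ler_normB _ _))// lerD2l mulr_suml.
    rewrite (le_trans (ler_norm_sum _ _ _))// big_nat [leRHS]big_nat.
    by apply: ler_sum => i /cM ci; rewrite normrZ mulrAC ler_wpM2r.
  have wv_le : `|w0 - v0| <= D * `|h|.
    have -> : w0 - v0 = \sum_(0 <= i < n) c i *: (v i - u (ku i)).
      rewrite /w0 /v0 opprB addrC subrKA -sumrB; apply: eq_bigr => i _.
      by rewrite scalerBr.
    rewrite (le_trans (ler_norm_sum _ _ _))// big_nat.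
    apply: (@le_trans _ _ (\sum_(0 <= i < n) M%:R * `|h| * eta)).
      rewrite [leRHS]big_nat; apply: ler_sum => i /cM ci.
      rewrite normrZ ler_pM//; last exact: ltW.
      by rewrite (le_trans ci)// ler_wpM2r.
    rewrite sumr_const_nat subn0 -[leLHS]mulr_natr.
    have -> : M%:R * `|h| * eta * n%:R =
        (M%:R / M.+1%:R) * (n%:R / n.+1%:R) * D * `|h|.
      by rewrite /eta /D natrM; field; rewrite !gt_eqF// addr_gt0.
    rewrite ler_wpM2r// ler_piMl//; first exact: ltW.
    by rewrite mulr_ile1// natr_divS_le1.
  have inG z : `|z| < rho -> x + z \in G.
    move=> zrho; apply/mem_set/rhoG.
    by rewrite -ball_normE /= opprD addNKr normrN.
  have vG : x + v0 \in G.
    apply/inG/(le_lt_trans v0_le); apply: le_lt_trans hrho.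
    by rewrite mulrC ler_wpM2l// lerDl ltW.
  have wG : x + w0 \in G.
    apply/inG; apply: le_lt_trans hrho.
    rewrite -(subrK v0 w0) mulrC mulrDl addrC.
    by rewrite (le_trans (ler_normD _ _))// lerD.
  have -> : f (x + w0) - f x - L w0 = (f (x + w0) - f (x + v0)) +
      (f (x + v0) - f x - L v0) - L (w0 - v0).
    by rewrite (linearB L w0 v0) opprB (addrA (_ - f (x + v0))) !subrKA.
  (* Passing from [w0] to [v0] costs [e / 8] through [f] and [L] together; the estimate along [V]
     costs the other [e / 8]. *)
  have -> : e / 4 * `|h| = K * (D * `|h|) + e / (8 * C) * (C * `|h|)
      + KL * (D * `|h|).
    by rewrite /D; field; rewrite !gt_eqF// addr_gt0.
  rewrite (le_trans (ler_normB _ _))// lerD//; last first.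
    by rewrite (le_trans (LKL _))// ler_pM2l.
  rewrite (le_trans (ler_normD _ _))// lerD//.
    rewrite (le_trans (fK _ _ wG vG))// opprD addrACA subrr add0r.
    by rewrite ler_pM2l.
  rewrite (le_trans (VL _ Vc _))//; last by rewrite ler_pM2l.
  by apply: le_lt_trans v0_le _; rewrite mulrC.
- move=> i iN; rewrite nth_mkseq//= (le_trans (ltW (kwP i)))// -/e1; lra.
- move=> i t iN tm; rewrite !nth_mkseq//= -/e1.
  rewrite -(subrK (t *: L (u (ku i))) (_ - f x)) -addrA -scalerBr.
  rewrite (le_trans (ler_normD _ _))//.
  rewrite (_ : e1 = e1 / 2 + e1 / 2); last by field.
  rewrite mulrDl lerD//; first exact: (delP i).2 (lt_trans tm (mdel i iN)).
  by rewrite normrZ mulrC ler_wpM2r// ltW.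
Qed.

End Pieces.

(** * The countable family of pieces *)

Theorem corollary5p7 (R : realType) (X Y : completeNormedModType R)
  (X_neq0 : exists x : X, x != 0) (Y_neq0 : exists y : Y, y != 0)
  (X_sep : separable X) (Y_sep : separable Y)
  (G : set X) (G_open : open G)
  (f : X -> Y) (f_lip : [lipschitz f x | x in G]) :
  sigma_porous [set x | [/\ G x,
    gateaux_differentiable f x,
    (exists V : closedSubspace X,
       finite_codim V /\ frechet_differentiable_along V f x) &
    ~ differentiable f x]].
Proof.
have [K K0 fK] := lipschitz_bound f_lip.
have [u u_dense] := separable_dense_seq X_sep.
have [w w_dense] := separable_dense_seq Y_sep.
(* Finite lists of index pairs keep the index type countable while the number of directions
   varies. *)
pose P (i : nat * nat * nat * seq (nat * nat)) : set X :=
  let: (q, M, m, s) := i in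
  piece G f q.+1%:R^-1 M m (size s) (fun j => u (nth (0, 0)%N s j).1)
    (fun j => w (nth (0, 0)%N s j).2).
apply: (@countable_union_sigma_porous _ _ _ P).
  by move=> [[[q M] m] s]; apply: piece_porous G_open K0 fK _; rewrite invr_gt0.
move=> x [Gx fx Vfx nd].
have [q [M [m [s Px]]]] :=
  piece_cover G_open K0 fK u_dense w_dense Gx fx Vfx nd.
by exists (q, M, m, s).
Qed.
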